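(* Suppose there exist a parameter value $\bar\theta\in\operatorname{int}\Theta$ (the interior of $\Theta$), a neighbourhood $M$ of $\bar\theta$, and a (possibly random) $\mathbb{R}^p$-valued function $G$ on $M$ such that: (i) $G_n(\bar\theta)\to 0$ $\mathbb{P}$-almost surely as $n\to\infty$, and $G(\bar\theta)=0$; (ii) for $\mathbb{P}$-almost all $\omega$, $G(\cdot,\omega)$ and all $G_n(\cdot,\omega)$ are continuously differentiable on $M$, and $\sup_{\theta\in M}\|\partial_\theta G_n(\theta)-\partial_\theta G(\theta)\|\to 0$ $\mathbb{P}$-almost surely; (iii) the matrix $\partial_\theta G(\bar\theta)$ is non-singular with $\mathbb{P}$-probability one. Then there exists a sequence $(\hat\theta_n)$ of $G_n$-estimators which is strongly $\bar\theta$-consistent.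
   Context: Setting: $(\Omega,\mathcal{F},\mathbb{P})$ is a complete probability space ($\mathbb{P}$ is the true measure), $\Theta\subseteq\mathbb{R}^p$ is the parameter set, and for each $n$, $\mathcal{F}_n\subseteq\mathcal{F}$ is a $\mathbb{P}$-complete sub-$\sigma$-field (generated by the observations at stage $n$). An estimating function at stage $n$ is a map $G_n:\Theta\times\Omega\to\mathbb{R}^p$ that is measurable with respect to the product of the Borel $\sigma$-field of $\Theta$ with $\mathcal{F}_n$; the argument $\omega$ is usually suppressed. $G_n$-estimators: let $\delta$ be an extra point outside $\Theta$ and $\Theta_\delta=\Theta\cup\{\delta\}$. Let $D_n$ be the set of all $\omega$ for which $G_n(\theta,\omega)=0$ for at least one $\theta\in\Theta$. A $G_n$-estimator is any $\mathcal{F}_n$-measurable map $\hat\theta_n:\Omega\to\Theta_\delta$ such that $\hat\theta_n\in\Theta$ and $G_n(\hat\theta_n)=0$ on $D_n$, and $\hat\theta_n=\delta$ on the complement of $D_n$. The metric on $\Theta_\delta$ is the Euclidean metric on $\Theta$, and the distance between $\delta$ and any point of $\Theta$ is $1$. A sequence $(\hat\theta_n)$ is strongly $\bar\theta$-consistent if $\hat\theta_n\to\bar\theta$ $\mathbb{P}$-almost surely as $n\to\infty$. $\|\cdot\|$ is the operator norm on $p\times p$ matrices (for the Euclidean norm), and $\partial_\theta G$ denotes the $p\times p$ Jacobian matrix.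
   Formalization: The parameter set Θ is assumed to be a Borel subset of R^p; for arbitrary Θ the claim fails, since the set D_n where G_n has a zero may be non-measurable, so that no G_n-estimator exists. *)

(* Defs.v *)
From HB Require Import structures.
From mathcomp Require Import all_boot all_order all_algebra.
From mathcomp Require Import all_classical all_reals all_analysis.
Set Implicit Arguments.
Unset Strict Implicit.
Unset Printing Implicit Defensive.
Import Order.TTheory GRing.Theory Num.Theory.
Import numFieldNormedType.Exports.
Local Open Scope classical_set_scope.
Local Open Scope ring_scope.

(* R^p with its Borel sigma-algebra.  Vectors are rows, as in the library's
   [jacobian]. *)
Notation borel_rV R p := (g_sigma_algebraType (@open ('rV[R]_p))).

(* The library norm on matrices is the sup norm, hence the two norms below. *)
Definition euclid (R : realType) (p : nat) (v : 'rV[R]_p) : R :=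
  Num.sqrt (\sum_(i < p) v ord0 i ^+ 2).

(* Matrices act on row vectors from the right, and [jacobian f x] is the
   transpose of the matrix of partial derivatives (d f_i / d x_j)_(i, j);
   neither the operator norm nor invertibility is affected. *)
Definition opnorm (R : realType) (p : nat) (A : 'M[R]_p) : R :=
  sup [set euclid (v *m A) | v in [set v : 'rV[R]_p | euclid v <= 1]].

(* Meaningful for M open. *)
Definition C1_on (R : realType) (p : nat) (M : set 'rV[R]_p)
    (f : 'rV[R]_p -> 'rV[R]_p) : Prop :=
  forall x, M x -> differentiable f x /\ {for x, continuous (jacobian f)}.

(* The completeness required is that of F for the restriction of P to F.  It
   follows if F contains every P-negligible set. *)
Definition complete_subfield (d : measure_display) (R : realType)
    (Omega : measurableType d) (P : probability Omega R)
    (F : set (set Omega)) : Prop :=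
  [/\ sigma_algebra setT F,
      F `<=` measurable &
      forall N B : set Omega, F B -> P B = 0%E -> N `<=` B -> F N].

(* Only the values of G on Theta matter. *)
Definition estimating_function (d : measure_display) (R : realType)
    (Omega : measurableType d) (p : nat) (Theta : set 'rV[R]_p)
    (F : set (set Omega)) (G : 'rV[R]_p -> Omega -> 'rV[R]_p) : Prop :=
  measurable_fun
    ((Theta : set (borel_rV R p)) `*` [set: g_sigma_algebraType F])
    (fun x : borel_rV R p * g_sigma_algebraType F =>
       G x.1 x.2 : borel_rV R p).

Definition solvable_event (R : realType) (Omega : Type) (p : nat)
    (Theta : set 'rV[R]_p) (G : 'rV[R]_p -> Omega -> 'rV[R]_p) : set Omega :=
  [set w | exists2 theta, Theta theta & G theta w = 0].

(* [None] is the extra point delta.  It is isolated in Theta_delta, so a set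
   of estimates is Borel iff its trace on R^p is. *)
Definition is_estimator (R : realType) (Omega : Type) (p : nat)
    (Theta : set 'rV[R]_p) (F : set (set Omega))
    (G : 'rV[R]_p -> Omega -> 'rV[R]_p)
    (that : Omega -> option 'rV[R]_p) : Prop :=
  [/\ forall A : set (option 'rV[R]_p),
        measurable (Some @^-1` A : set (borel_rV R p)) -> F (that @^-1` A),
      forall w, solvable_event Theta G w ->
        exists theta, [/\ that w = Some theta, Theta theta & G theta w = 0] &
      forall w, ~ solvable_event Theta G w -> that w = None].

Definition dist_delta (R : realType) (p : nat) (x y : option 'rV[R]_p) : R :=
  match x, y with
  | Some a, Some b => euclid (a - b)
  | None, None => 0
  | _, _ => 1
  end.

Definition strongly_consistent (d : measure_display) (R : realType)
    (Omega : measurableType d) (P : probability Omega R) (p : nat)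
    (thetabar : 'rV[R]_p) (that : nat -> Omega -> option 'rV[R]_p) : Prop :=
  {ae P, forall w,
    (fun n => dist_delta (that n w) (Some thetabar)) @ \oo --> (0 : R)}.

(* Main.v *)
(** A zero of [Gn n w] near [thetabar] exists for large [n] because
    [x |-> x - Gn n x w *m invmx (jacobian (G^~ w) thetabar)] is eventually a
    contraction of any small ball around [thetabar]: by the uniform convergence
    of the Jacobians its derivative is small there, and its displacement of the
    centre tends to 0.

    What remains is to choose zeros measurably.  Only joint measurability is
    available on [Theta], so this needs the Aumann--von Neumann theorem: a
    measurable subset of [R^p * T] has, when [T] carries a complete finite
    measure, a measurable projection and a measurable selector.  Measurable sets
    are Suslin sets over closed-times-measurable rectangles; Choquet's
    capacitability argument exhausts the projection of a Suslin set, up to a null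
    set, by projections of sets with compact sections, and on the latter a
    selector is obtained by successive intersection with half-spaces.

    The n-th estimator selects from the zeros [x] of [Gn n] subject to
    [|x - thetabar| <= 1 / (k + 1)] for every [k < n] such that some zero
    satisfies this bound. *)
Require Import Defs.
From HB Require Import structures.
From mathcomp Require Import all_boot all_order all_algebra.
From mathcomp Require Import all_classical all_reals all_analysis.
From mathcomp Require Import zify ring lra.
Import Order.TTheory GRing.Theory Num.Theory.
Import numFieldNormedType.Exports.
Local Open Scope classical_set_scope.
Local Open Scope ring_scope.

Set Implicit Arguments.
Unset Strict Implicit.

(** * Suslin sets over rectangles *)

Lemma mkseqS_cons (U : Type) (x : nat -> U) (n : nat) :
  mkseq x n.+1 = x 0%N :: mkseq (x \o S) n.
Proof. by rewrite /mkseq /= (iotaDl 1 0) -map_comp. Qed.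

Lemma eq_in_mkseq (U : Type) (x y : nat -> U) (n : nat) :
  (forall k, (k < n)%N -> x k = y k) -> mkseq x n = mkseq y n.
Proof. by move=> xy; apply/eq_in_map => k; rewrite mem_iota => /xy. Qed.

(** Dependent choice along prefixes. It serves both for Koenig's lemma and for choosing the bounding
    sequence in the capacitability argument. *)
Lemma nat_seq_path (Q : seq nat -> Prop) :
  Q [::] -> (forall s, Q s -> exists i, Q (rcons s i)) ->
  exists x : nat -> nat, forall n, Q (mkseq x n).
Proof.
move=> Q0 QS.
have /choice[next nextP] : forall s, exists i, Q s -> Q (rcons s i).
  move=> s; have [/QS[i Qi]|] := pselect (Q s); first by exists i.
  by exists 0%N.
pose l n := iter n (fun s => rcons s (next s)) [::].
exists (fun n => next (l n)) => n; suff -> : mkseq (fun n => next (l n)) n = l n.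
  by elim: n => //= n; exact: nextP.
by elim: n => // n; rewrite mkseqS => ->.
Qed.

(* The map [(i, k) |-> 2 ^ i * (2 k + 1) - 1] is a bijection from pairs to
   integers, increasing in [k]. *)
Definition pair_code (i k : nat) : nat := (2 ^ i * k.*2.+1).-1.

Definition pair_decode (m : nat) : nat * nat :=
  let i := logn 2 m.+1 in (i, (m.+1 %/ 2 ^ i)./2).

Lemma pair_codeS (i k : nat) : (pair_code i k).+1 = (2 ^ i * k.*2.+1)%N.
Proof. by rewrite prednK// muln_gt0 expn_gt0. Qed.

Lemma pair_codeK (i k : nat) : pair_decode (pair_code i k) = (i, k).
Proof.
rewrite /pair_decode pair_codeS lognM ?expn_gt0// pfactorK//.
have -> : logn 2 k.*2.+1 = 0%N.
  by apply: logn_coprime; rewrite coprime2n /= odd_double.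
by rewrite addn0 mulKn ?expn_gt0//= uphalf_double.
Qed.

(** A prefix of length [m] of an interleaved sequence thus already contains every entry that its
    decoded test reads. *)
Lemma pair_code_lt (m k : nat) :
  (k < (pair_decode m).2)%N -> (pair_code (pair_decode m).1 k < m)%N.
Proof.
rewrite /pair_decode /=; set i := logn 2 m.+1; set q := (m.+1 %/ 2 ^ i)%N => kq.
rewrite -ltnS pair_codeS.
apply: (@leq_trans (2 ^ i * q)); last by rewrite mulnC leq_divM.
rewrite ltn_mul2l expn_gt0/=; have := half_leq kq.
by move: kq; rewrite -[in (_.*2.+1 < q)%N](odd_double_half q); case: (odd q) => /=; lia.
Qed.

Section suslin.
Context d (T : measurableType d) (X : topologicalType).

(** The Suslin operation applied to rectangles with one closed and one measurable side. *)
Definition suslin (A : set (X * T)) : Prop :=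
  exists (K : seq nat -> set X) (E : seq nat -> set T),
    [/\ forall s, closed (K s), forall s, measurable (E s) &
    A = [set z | exists x : nat -> nat, forall n, (K (mkseq x n) `*` E (mkseq x n)) z]].

Lemma suslin_rectangle (K : set X) (E : set T) :
  closed K -> measurable E -> suslin (K `*` E).
Proof.
move=> cK mE; exists (fun=> K), (fun=> E); split => //.
by apply/seteqP; split => [z Az|z [_ /(_ 0%N)//]]; exists (fun=> 0%N).
Qed.

Lemma suslin_setT : suslin [set: X * T].
Proof.
have := @suslin_rectangle setT setT closedT measurableT.
by rewrite setXTT.
Qed.

(** The first entry of a branch names the index [i]; the remaining entries form a branch for
    [A i]. *)
Lemma suslin_bigcup (A : nat -> set (X * T)) :
  (forall i, suslin (A i)) -> suslin (\bigcup_i A i).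
Proof.
move=> /choice[K /choice[E KE]].
pose pick V (B : nat -> seq nat -> set V) (s : seq nat) :=
  if s is i :: s' then B i s' else setT.
exists (pick X K), (pick T E); split.
- by move=> [|i s]; [exact: closedT|have [+ _ _] := KE i; exact].
- by move=> [|i s]; [exact: measurableT|have [_ + _] := KE i; exact].
apply/seteqP; split => [z [i _]|z [x xz]].
  have [_ _ -> [x xz]] := KE i.
  exists (fun n => if n is m.+1 then x m else i) => -[//|n].
  by rewrite mkseqS_cons; exact: xz.
exists (x 0%N) => //; have [_ _ ->] := KE (x 0%N).
by exists (x \o S) => n; have := xz n.+1; rewrite mkseqS_cons.
Qed.

(** One branch interleaves a branch for each [A i], entry [k] of the [i]-th being stored at
    [pair_code i k]. A prefix of length [m] tests the [i]-th branch at length [n], where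
    [(i, n) = pair_decode m], so every pair gets tested. *)
Lemma suslin_bigcap (A : nat -> set (X * T)) :
  (forall i, suslin (A i)) -> suslin (\bigcap_i A i).
Proof.
move=> /choice[K /choice[E KE]].
pose pick V (B : nat -> seq nat -> set V) (s : seq nat) :=
  let: (i, n) := pair_decode (size s) in
  B i (mkseq (fun k => nth 0%N s (pair_code i k)) n).
exists (pick X K), (pick T E); split.
- by move=> s; rewrite /pick; case: pair_decode => i n; have [+ _ _] := KE i; exact.
- by move=> s; rewrite /pick; case: pair_decode => i n; have [_ + _] := KE i; exact.
apply/seteqP; split => [z Az|z [y yz] i _].
  have /choice[x xz] : forall i, exists x : nat -> nat,
      forall n, (K i (mkseq x n) `*` E i (mkseq x n)) z.
    by move=> i; have := Az i I; have [_ _ ->] := KE i.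
  pose y m := x (pair_decode m).1 (pair_decode m).2.
  exists y => m; rewrite /pick size_mkseq.
  case D : (pair_decode m) => [i n].
  rewrite (@eq_in_mkseq _ _ (x i))// => k kn.
  rewrite nth_mkseq ?/y ?pair_codeK//.
  by have := @pair_code_lt m k; rewrite D; exact.
have [_ _ ->] := KE i; exists (fun k => y (pair_code i k)) => n.
have := yz (pair_code i n); rewrite /pick size_mkseq pair_codeK.
rewrite (@eq_in_mkseq _ _ (fun k => y (pair_code i k)))// => k kn.
rewrite nth_mkseq// -ltnS !pair_codeS ltn_mul2l expn_gt0/=.
by lia.
Qed.

Lemma suslinI (A B : set (X * T)) : suslin A -> suslin B -> suslin (A `&` B).
Proof.
move=> sA sB; rewrite -bigcap2E; apply: suslin_bigcap => -[|[|i]] //=.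
exact: suslin_setT.
Qed.

(** Suslin sets are in general not stable under complement; asking for both sides restores a
    sigma-algebra. *)
Definition bisuslin (A : set (X * T)) : Prop := suslin A /\ suslin (~` A).

Lemma sigma_algebra_bisuslin : sigma_algebra setT bisuslin.
Proof.
split.
- split.
    have := @suslin_rectangle setT set0 closedT measurable0.
    by rewrite setX0.
  by rewrite setC0; exact: suslin_setT.
- by move=> A [sA sCA]; rewrite /bisuslin setTD setCK.
- move=> A sA; split; first by apply: suslin_bigcup => i; have [] := sA i.
  by rewrite setC_bigcup; apply: suslin_bigcap => i; have [] := sA i.
Qed.

End suslin.

(** Bi-Suslin sets form a sigma-algebra, so cylinders over generators suffice. Over an open set the
    complement is a closed cylinder, and the cylinder itself is a countable union of closed ones. *)
Lemma measurable_suslin d (T : measurableType d) (X : ptopologicalType)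
    (A : set (g_sigma_algebraType (@open X) * T)) :
  (forall U : set X, open U ->
    exists K : nat -> set X, (forall n, closed (K n)) /\ U = \bigcup_n K n) ->
  measurable A -> suslin (A : set (X * T)).
Proof.
move=> Fsigma mA; have sigma_bi := @sigma_algebra_bisuslin _ T X.
suff /(_ A mA)[] : @measurable _ (g_sigma_algebraType (@open X) * T)%type
    `<=` @bisuslin _ T X by [].
apply: smallest_sub => // {mA}A [|] [B mB <-]; rewrite setTI.
  suff sub : <<s @open X >> `<=` image_set_system setT fst (@bisuslin _ T X).
    by have := sub B mB; rewrite /image_set_system/= setTI.
  apply: smallest_sub; first exact: sigma_algebra_image.
  move=> U oU /=; rewrite /image_set_system/= setTI; split.
    have [K [cK ->]] := Fsigma U oU.
    rewrite preimage_bigcup; apply: suslin_bigcup => n.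
    by rewrite -setXT; exact: suslin_rectangle.
  rewrite (_ : ~` _ = (~` U) `*` setT); last by apply/seteqP; split=> z //= -[].
  by apply: suslin_rectangle => //; exact: open_closedC.
split; first by rewrite -setTX; apply: suslin_rectangle => //; exact: closedT.
rewrite (_ : ~` _ = setT `*` (~` B)); last by apply/seteqP; split=> z //= -[].
by apply: suslin_rectangle; [exact: closedT|exact: measurableC].
Qed.

Lemma nested_compact (X : ptopologicalType) (V : set X) (C : nat -> set X) :
  compact V -> (forall n, closed (C n)) -> (forall n, C n.+1 `<=` C n) ->
  (forall n, V `&` C n !=set0) -> exists x, V x /\ forall n, C n x.
Proof.
move=> + cC Cdec VC; rewrite compact_In0 => Vco.
have Cmono m n : (m <= n)%N -> C n `<=` C m.
  elim: n => [|n IH]; first by rewrite leqn0 => /eqP ->.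
  rewrite leq_eqVlt => /predU1P[->//|/IH h x /Cdec]; exact: h.
have [||x xVC] := Vco nat setT (fun n => V `&` C n).
- by exists C.
(* As [C] decreases, a finite intersection contains its member of largest index. *)
- move=> D _; have [x [Vx Cx]] := VC (\max_(i <- finmap.enum_fset D) i)%N.
  exists x => i /= Di; split=> //; apply: Cmono Cx.
  exact: leq_bigmax_seq.
- by exists x; split=> [|n]; [have [] := xVC 0%N I|have [] := xVC n I].
Qed.

Section outer_small.
Context d (T : measurableType d) (R : realType).
Variable mu : {measure set T -> \bar R}.
Local Open Scope ereal_scope.

(* Stands for [mu^* B <= a] with the infimum attained. *)
Definition outer_le (a : \bar R) (B : set T) : Prop :=
  exists C, [/\ measurable C, B `<=` C & mu C <= a].

(** Continuity from below of the outer measure: the intersection of the covers [C m], [m >= n],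
    still covers [B n], and these intersections increase with [n]. *)
Lemma outer_le_bigcup (a : \bar R) (B : nat -> set T) :
  (forall n, B n `<=` B n.+1) -> (forall n, outer_le a (B n)) ->
  outer_le a (\bigcup_n B n).
Proof.
move=> Binc /choice[C BC].
have Bmono m n : (m <= n)%N -> B m `<=` B n.
  elim: n => [|n IH]; first by rewrite leqn0 => /eqP ->.
  rewrite leq_eqVlt => /predU1P[->//|/IH h x /h]; exact: Binc.
pose D n := \bigcap_(m in [set m | (n <= m)%N]) C m.
have mD n : measurable (D n).
  by apply: bigcap_measurableType => m _; have [] := BC m.
have mUD : measurable (\bigcup_n D n) by exact: bigcupT_measurable.
exists (\bigcup_n D n); split => //.
  move=> t [n _ Bt]; exists n => // m /= nm; have [_ + _] := BC m; apply.
  exact: Bmono Bt.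
have Dmu : mu \o D @ \oo --> mu (\bigcup_n D n).
  apply: nondecreasing_cvg_mu => // m n mn; apply/subsetPset => t Dt k /= nk.
  by apply: Dt => /=; exact: leq_trans nk.
rewrite -(cvg_lim _ Dmu)//; apply: lime_le.
  by apply/cvg_ex; exists (mu (\bigcup_n D n)).
apply: nearW => n /=; have [mC _ Ca] := BC n; apply: le_trans Ca.
by apply: le_measure; rewrite ?inE// => t /(_ n)/=; exact.
Qed.

End outer_small.

(** * Branches of a Suslin scheme with bounded entries *)

Section bounded_branch.
Context d (T : measurableType d) (X : ptopologicalType).
Variables (K : seq nat -> set X) (E : seq nat -> set T).
Hypotheses (cK : forall s, closed (K s)) (mE : forall s, measurable (E s)).

(** Points that survive [k] levels beyond the prefix [s] when entry [j] is at most [m j]. Only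
    finite unions occur, which keeps sections closed and projections measurable. *)
Fixpoint bounded_branch (m : nat -> nat) (k : nat) (s : seq nat) : set (X * T) :=
  (K s `*` E s) `&`
  if k is k'.+1 then
    \bigcup_(i in `I_(m (size s)).+1) bounded_branch m k' (rcons s i)
  else setT.

Lemma bounded_branchS m k s z :
  bounded_branch m k.+1 s z -> bounded_branch m k s z.
Proof.
elim: k s => [|k IH] s /=; first by case.
by move=> [Sz [i im /IH bz]]; split=> //; exists i.
Qed.

Lemma bounded_branch_le m j k s z : (j <= k)%N ->
  bounded_branch m k s z -> bounded_branch m j s z.
Proof.
elim: k => [|k IH]; first by rewrite leqn0 => /eqP ->.
by rewrite leq_eqVlt => /predU1P[->//|/IH jk] /bounded_branchS.
Qed.

Lemma closed_bounded_branch m k s t : closed [set x | bounded_branch m k s (x, t)].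
Proof.
elim: k s => [|k IH] s /=.
  have [Et|nEt] := pselect (E s t).
    rewrite (_ : mkset _ = K s)//; apply/seteqP; by split => x //= [[]].
  rewrite (_ : mkset _ = set0)//; first exact: closed0.
  by apply/seteqP; split => x //= [[]].
have [Et|nEt] := pselect (E s t); last first.
  rewrite (_ : mkset _ = set0)//; first exact: closed0.
  by apply/seteqP; split => x //= [[]].
rewrite (_ : mkset _ = K s `&` \bigcup_(i in `I_(m (size s)).+1)
    [set x | bounded_branch m k (rcons s i) (x, t)]).
  by apply: closedI => //; apply: closed_bigcup => // i _; exact: IH.
by apply/seteqP; split => [x [[? _] [i im b]]|x [? [i im b]]]; split=> //; exists i.
Qed.

(** With [L] arbitrary, the induction can absorb [K s] into it; at depth 0 the set is [E s] or
    empty. *)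
Lemma measurable_bounded_branch_hit m k s (L : set X) : closed L ->
  measurable [set t | exists2 x, L x & bounded_branch m k s (x, t)].
Proof.
elim: k s L => [|k IH] s L cL /=.
  have [[x [Lx Kx]]|LK] := pselect (L `&` K s !=set0).
    rewrite (_ : mkset _ = E s)//; apply/seteqP; split => [t [y _ [[]]]//|t Et].
    by exists x.
  rewrite (_ : mkset _ = set0)//; apply/seteqP; split => t //= [x Lx [[Kx _] _]].
  by apply: LK; exists x.
rewrite (_ : mkset _ = E s `&` \bigcup_(i in `I_(m (size s)).+1)
    [set t | exists2 x, (L `&` K s) x & bounded_branch m k (rcons s i) (x, t)]).
  apply: measurableI => //; apply: bigcup_measurable => i _.
  by apply: IH; exact: closedI.
apply/seteqP; split => [t [x Lx [[Kx Et] [i im b]]]|t [Et [i im [x [Lx Kx] b]]]].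
  by split=> //; exists i => //; exists x.
by exists x => //; split=> //; exists i.
Qed.

(* Koenig's lemma: the tree of branches bounded by [m] is finitely branching. *)
Lemma bounded_branch_koenig m z : (forall k, bounded_branch m k [::] z) ->
  exists x : nat -> nat, forall n, (K (mkseq x n) `*` E (mkseq x n)) z.
Proof.
move=> bz.
have [||x xz] := @nat_seq_path (fun s => forall k, bounded_branch m k s z).
- exact: bz.
- move=> s sz; apply: contrapT => /forallNP noext.
  (* If each child dies at some depth [k i], the maximum over the finitely many allowed children
     bounds the survival of [s]. *)
  have /choice[k kP] : forall i, exists k, ~ bounded_branch m k (rcons s i) z.
    by move=> i; apply/existsNP; exact: noext.
  have [_ [i im]] := sz (\max_(i < (m (size s)).+1) k i).+1.
  have ki := leq_bigmax (F := fun i : 'I_(m (size s)).+1 => k i) (Ordinal im).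
  by move=> /(bounded_branch_le ki)/kP.
- by exists x => n; have [] := xz n 0%N.
Qed.

Lemma bounded_branch_mkseq m (x : nat -> nat) k n z :
  (forall n, (K (mkseq x n) `*` E (mkseq x n)) z) ->
  (forall i, (i < n + k)%N -> (x i <= m i)%N) ->
  bounded_branch m k (mkseq x n) z.
Proof.
move=> xz; elim: k n => [|k IH] n xm /=; first by split=> //; exact: xz.
split; first exact: xz.
exists (x n); first by rewrite size_mkseq /= ltnS xm// addnS ltnS leq_addr.
by rewrite -mkseqS; apply: IH => i; rewrite addSnnS => /xm.
Qed.

End bounded_branch.

(** * Capacitability and measurable selection *)

Section selectable.
Context d (T : measurableType d) (X : ptopologicalType).

Definition hit_measurable (C : T -> set X) : Prop :=
  forall L, closed L -> measurable [set t | C t `&` L !=set0].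

Definition selectable (A : set (X * T)) : Prop :=
  exists f : T -> X, [/\ measurable (snd @` A),
    forall t, (snd @` A) t -> A (f t, t) &
    forall L, closed L -> measurable (snd @` A `&` f @^-1` L)].

Lemma selectable_sub (A B : set (X * T)) :
  B `<=` A -> snd @` A `<=` snd @` B -> selectable B -> selectable A.
Proof.
move=> BA AB [f [mB fB mfB]].
have E : snd @` A = snd @` B by apply/seteqP; split => // t [z /BA]; exists z.
by exists f; rewrite E; split => // t /fB/BA.
Qed.

(** At [t], use the selector of the first [A n] whose projection contains [t]; [seqDU] makes these
    regions disjoint. *)
Lemma selectable_bigcup (A : nat -> set (X * T)) :
  (forall n, selectable (A n)) -> selectable (\bigcup_n A n).
Proof.
move=> /choice[f fA]; pose D n := snd @` A n.
have DE : snd @` (\bigcup_n A n) = \bigcup_n D n by rewrite image_bigcup.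
have mD n : measurable (D n) by have [] := fA n.
have /choice[i iP] : forall t, exists i, (\bigcup_n D n) t -> seqDU D i t.
  move=> t; have [|nt] := pselect ((\bigcup_n D n) t); last by exists 0%N.
  by rewrite [X in X t -> _]seqDU_bigcup_eq => -[i _ it]; exists i.
exists (fun t => f (i t) t); rewrite DE; split.
- exact: bigcupT_measurable.
- move=> t Dt; exists (i t) => //; have [_ + _] := fA (i t); apply.
  by have [+ _] := iP t Dt.
move=> L cL; rewrite (_ : _ `&` _ = \bigcup_n (seqDU D n `&` (D n `&` f n @^-1` L))).
  apply: bigcupT_measurable => n; apply: measurableI.
    apply: measurableD => //; exact: bigsetU_measurable.
  by have [_ _] := fA n; exact.
apply/seteqP; split => [t [Dt Lt]|t [n _ [nt [Dt Lt]]]].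
  by exists (i t) => //; have it := iP t Dt; split=> //; split=> //; have [+ _] := it.
have Ut : (\bigcup_n D n) t by exists n.
split=> //=; suff -> : i t = n by [].
by apply: (@trivIset_seqDU _ D) => //; exists t; split => //; exact: iP.
Qed.

(** Over the points missed by [B], a null set, every subset is measurable by completeness, so any
    choice of values is a measurable selector. *)
Lemma selectable_negligible (R : realType) (mu : {measure set T -> \bar R})
    (A B : set (X * T)) : measure_is_complete mu ->
  B `<=` A -> mu.-negligible (snd @` A `\` snd @` B) ->
  selectable B -> selectable A.
Proof.
move=> cmu BA [N [mN N0 ABN]] sB.
pose A' := A `&` [set z | ~ (snd @` B) z.2].
have A'N : snd @` A' `<=` N.
  by move=> t [z [Az nBz] <-]; apply: ABN; split => //; exists z.
have mnegl S : S `<=` N -> measurable S.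
  by move=> SN; apply: cmu; exists N; split.
have sA' : selectable A'.
  have /choice[f fA'] : forall t, exists x, (snd @` A') t -> A' (x, t).
    move=> t; have [[[x s] Az /= <-]|nt] := pselect ((snd @` A') t).
      by exists x.
    by exists point.
  exists f; split => //; first exact: mnegl.
  by move=> L _; apply: mnegl => t [/A'N].
apply: (@selectable_sub _ (\bigcup_n (if n is 0%N then B else A'))).
- by move=> z [[_ /BA//|n _ []//]].
- move=> t [z Az <-]; have [Bt|nBt] := pselect ((snd @` B) z.2).
    by case: Bt => y By <-; exists y => //; exists 0%N.
  by exists z => //; exists 1%N.
- by apply: selectable_bigcup => -[|n].
Qed.

(* The first [n] steps of a search that intersects with [U 0, U 1, ...]
   in turn, skipping the sets that would leave nothing. *)
Fixpoint refine (U : nat -> set X) (C : set X) (n : nat) : set X :=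
  if n is m.+1 then
    [set x | refine U C m x /\ (refine U C m `&` U m !=set0 -> U m x)]
  else C.

Lemma refine_sub U C n : refine U C n.+1 `<=` refine U C n.
Proof. by move=> x []. Qed.

Lemma refine_sub0 U C n : refine U C n `<=` C.
Proof. by elim: n => // n IH x /refine_sub/IH. Qed.

Lemma closed_refine U C n :
  closed C -> (forall k, closed (U k)) -> closed (refine U C n).
Proof.
move=> cC cU; elim: n => //= n IH.
have [H|nH] := pselect (refine U C n `&` U n !=set0).
  rewrite (_ : mkset _ = refine U C n `&` U n); first exact: closedI.
  by apply/seteqP; split => x [? h]; split => //; exact: h.
rewrite (_ : mkset _ = refine U C n)//.
by apply/seteqP; split => x //= [].
Qed.

Lemma refine_neq0 U C n : C !=set0 -> refine U C n !=set0.
Proof.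
move=> C0; elim: n => //= n [x Cx].
have [[y [Cy Uy]]|nH] := pselect (refine U C n `&` U n !=set0).
  by exists y.
by exists x.
Qed.

Lemma refine_hit_measurable U (C : T -> set X) n :
  (forall k, closed (U k)) -> hit_measurable C ->
  hit_measurable (fun t => refine U (C t) n).
Proof.
move=> cU hC; elim: n => //= n IH L cL.
(* The parameters for which step [n] is not skipped; the claim is proved separately on [D] and off
   it. *)
pose D := [set t | refine U (C t) n `&` U n !=set0].
have mD : measurable D by exact: IH.
rewrite (_ : mkset _ = (D `&` [set t | refine U (C t) n `&` (U n `&` L) !=set0])
    `|` (~` D `&` [set t | refine U (C t) n `&` L !=set0])).
  apply: measurableU; apply: measurableI => //.
  - by apply: IH; exact: closedI.
  - exact: measurableC.
  - exact: IH.
apply/seteqP; split => [t [x [[Cx xU] Lx]]|t [[Dt [x [Cx [Ux Lx]]]]|[nDt [x [Cx Lx]]]]].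
- have [Dt|nDt] := pselect (D t).
    by left; split => //; exists x; split => //; split => //; exact: xU.
  by right; split => //; exists x.
- by exists x; split => //; split.
- by exists x; split => //; split => // /nDt.
Qed.

(** After step [k] all remaining points agree on membership in [U k], so at most one point survives
    every step; compactness provides one. *)
Lemma hit_measurable_selectable (U : nat -> set X) (V : set X) (C : T -> set X) :
  (forall k, closed (U k)) ->
  (forall x y, (forall k, U k x <-> U k y) -> x = y) ->
  compact V -> closed V -> (forall t, closed (C t)) -> (forall t, C t `<=` V) ->
  hit_measurable C -> selectable [set z | C z.2 z.1].
Proof.
move=> cU sepU Vco cV cC CV hC.
have DE : snd @` [set z | C z.2 z.1] = [set t | C t `&` setT !=set0].
  apply/seteqP; split => [_ [[x t] /= Cx <-]|t [x [Cx _]]]; first by exists x.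
  by exists (x, t).
have hit t L : closed L -> (forall n, refine U (C t) n `&` L !=set0) ->
    exists x, forall n, refine U (C t) n x /\ L x.
  move=> cL tL.
  have [||||x [_ xC]] := @nested_compact X V (fun n => refine U (C t) n `&` L).
  - by [].
  - by move=> n; apply: closedI => //; exact: closed_refine.
  - by move=> n x [/refine_sub ? ?].
  - move=> n; have [x [Cx Lx]] := tL n.
    by exists x; split => //; apply: CV; exact: refine_sub0 Cx.
  - by exists x.
have uniq t x y : (forall n, refine U (C t) n x) ->
    (forall n, refine U (C t) n y) -> x = y.
  move=> Cx Cy; apply: sepU => k; split => Uk.
    by have [_] := Cy k.+1; apply; exists x; split => //; exact: Cx.
  by have [_] := Cx k.+1; apply; exists y; split => //; exact: Cy.
have /choice[f fC] : forall t, exists x, C t !=set0 -> forall n, refine U (C t) n x.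
  move=> t; have [Ct|nCt] := pselect (C t !=set0); last by exists point.
  have [|n|x xC] := hit t setT; first exact: closedT.
    by rewrite setIT; exact: refine_neq0.
  by exists x => _ n; have [] := xC n.
exists f; rewrite DE; split.
- by apply: hC; exact: closedT.
- move=> t; rewrite /= setIT => Ct.
  by have := fC t Ct 0%N.
move=> L cL.
(* If every stage meets [L], compactness gives a survivor in [L], which by uniqueness is [f t]. *)
rewrite (_ : _ `&` _ = \bigcap_n [set t | refine U (C t) n `&` L !=set0]).
  by apply: bigcap_measurableType => n _; exact: refine_hit_measurable.
apply/seteqP; split => [t /= []|t /= tL].
  by rewrite setIT => /fC tC Lt n _; exists (f t).
have [|n|x xC] := hit t L; [exact: cL|exact: tL|].
have Ct : C t !=set0 by exists x; have [] := xC 0%N.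
split; first by rewrite setIT.
have -> : f t = x by apply: (uniq t); [exact: fC|move=> n; have [] := xC n].
by have [] := xC 0%N.
Qed.

End selectable.

Section capacity.
Context d (T : measurableType d) (X : ptopologicalType) (R : realType).
Variable mu : {finite_measure set T -> \bar R}.
Local Open Scope ereal_scope.

(* Choquet's capacitability theorem for the capacity [A |-> mu^*(snd @` A)]. *)
Lemma suslin_inner_compact (A : set (X * T)) (V : set X) (a : \bar R) :
  compact V -> closed V -> suslin A -> (forall z, A z -> V z.1) ->
  ~ outer_le mu a (snd @` A) ->
  exists C : T -> set X, [/\ forall t, closed (C t) /\ C t `<=` V,
    hit_measurable C, [set z | C z.2 z.1] `<=` A &
    a <= mu (snd @` [set z | C z.2 z.1])].
Proof.
move=> Vco cV [K [E [cK mE AE]]] AV nA.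
pose Al (l : seq nat) := [set z | exists x : nat -> nat,
  (forall i, (i < size l)%N -> (x i <= nth 0%N l i)%N) /\
  forall n, (K (mkseq x n) `*` E (mkseq x n)) z].
(* The bounds [m] are chosen one at a time: [Al s] is the increasing union of the [Al (rcons s i)],
   so by continuity from below some [i] keeps the outer measure above [a]. *)
have [|s sP|m mP] := @nat_seq_path (fun l => ~ outer_le mu a (snd @` Al l)).
- move=> h; apply: nA; suff -> : A = Al [::] by []; rewrite AE.
  by apply/seteqP; split => z [x]; [move=> xz|case=> _ xz]; exists x.
- apply: contrapT => /forallNP h; apply: sP.
  have {}h i : outer_le mu a (snd @` Al (rcons s i)) by exact: contrapT (h i).
  rewrite (_ : snd @` Al s = \bigcup_i (snd @` Al (rcons s i))).
    apply: outer_le_bigcup h => i t [z [x [xs xz]] <-]; exists z => //.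
    exists x; split => // j; rewrite size_rcons => js; apply: leq_trans (xs j _) _.
      by rewrite size_rcons.
    by rewrite !nth_rcons; case: ifPn => // _; case: ifPn.
  rewrite -image_bigcup; congr (_ @` _); apply/seteqP; split => [z [x [xs xz]]|].
    exists (x (size s)) => //; exists x; split => // i.
    rewrite size_rcons nth_rcons ltnS leq_eqVlt => /predU1P[->|is_].
      by rewrite ltnn eqxx.
    by rewrite is_ xs.
  move=> z [i _ [x [xs xz]]]; exists x; split => // j js.
  by have := xs j; rewrite size_rcons nth_rcons js; apply; exact: ltnW.
pose bb k t := [set x | bounded_branch K E m k [::] (x, t)].
(* Koenig's lemma places these sections inside [A]; compactness of [V] lets the intersection over
   [k] be tested level by level. *)
pose C t := V `&` \bigcap_k bb k t.
have cbb k t : closed (bb k t) by exact: closed_bounded_branch.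
have hitE L : closed L -> [set t | C t `&` L !=set0] =
    \bigcap_k [set t | exists2 x, (V `&` L) x & bb k t x].
  move=> cL; apply/seteqP; split => [t [x [[Vx bx] Lx]] k _|t tb].
    by exists x => //; exact: bx.
  have [||||x [Vx xb]] := @nested_compact X V (fun n => bb n t `&` L).
  - by [].
  - by move=> n; exact: closedI.
  - by move=> n x [bx Lx]; split => //; exact: bounded_branchS bx.
  - by move=> n; have [x [Vx Lx] bx] := tb n I; exists x.
  - exists x; split; last by have [] := xb 0%N.
    by split => // k _; have [] := xb k.
have mhit L k : closed L -> measurable [set t | exists2 x, (V `&` L) x & bb k t x].
  by move=> cL; apply: measurable_bounded_branch_hit => //; exact: closedI.
exists C; split.
- move=> t; split; last by move=> x [].
  by apply: closedI => //; apply: closed_bigI => k _.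
- move=> L cL; rewrite hitE//; apply: bigcap_measurableType => k _; exact: mhit.
- move=> [x t] [Vx bx]; rewrite AE; apply: bounded_branch_koenig => k.
  exact: bx.
rewrite (_ : snd @` _ = [set t | C t `&` setT !=set0]); last first.
  apply/seteqP; split => [_ [[x t] /= Cx <-]|t [x [Cx _]]]; first by exists x.
  by exists (x, t).
rewrite hitE; last exact: closedT.
set F := fun k => _; have mF k : measurable (F k) by apply: mhit; exact: closedT.
have Fmu : mu \o F @ \oo --> mu (\bigcap_k F k).
  apply: nonincreasing_cvg_mu => //.
  - by rewrite ltey_eq fin_num_measure.
  - exact: bigcap_measurableType.
  - move=> i j ij; apply/subsetPset => t [x Vx bx]; exists x => //.
    exact: bounded_branch_le bx.
rewrite -(cvg_lim _ Fmu)//; apply: lime_ge.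
  by apply/cvg_ex; exists (mu (\bigcap_k F k)).
(* [F k] covers the projection of [Al (mkseq m k)], so a measure below [a] would contradict the
   choice of [m]. *)
apply: nearW => k /=; have [//|Fa] := leP a (mu (F k)); exfalso.
apply: (mP k); exists (F k); split => //; last exact: ltW.
move=> _ [[x t] [y [ym yz]] <-] /=; exists x.
  by split => //; apply: (AV (x, t)); rewrite AE; exists y.
apply: (@bounded_branch_mkseq _ _ _ _ _ m y k 0) => // i ik.
by have := ym i; rewrite size_mkseq nth_mkseq// => /(_ ik).
Qed.

End capacity.

(** * The Aumann--von Neumann selection theorem *)

Section measurable_selection.
Context d (T : measurableType d) (R : realType).
Variable mu : {finite_measure set T -> \bar R}.
Hypothesis cmu : measure_is_complete mu.

Section general.
Variables (X : ptopologicalType) (U : nat -> set X).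
Hypotheses (cU : forall k, closed (U k))
  (sepU : forall x y, (forall k, U k x <-> U k y) -> x = y).
Local Open Scope ereal_scope.

(** With [c] the outer measure of the projection, capacitability gives selectable subsets whose
    projections have measure at least [c - 1/(n+1)]; their union misses only a null set of
    parameters. *)
Lemma suslin_compact_selectable (A : set (X * T)) (V : set X) :
  compact V -> closed V -> suslin A -> (forall z, A z -> V z.1) ->
  selectable A.
Proof.
move=> Vco cV sA AV.
pose cover := [set mu B | B in [set B | measurable B /\ snd @` A `<=` B]].
pose c := ereal_inf cover.
have cle B : measurable B -> snd @` A `<=` B -> c <= mu B.
  by move=> mB AB; apply: ereal_inf_lbound; exists B.
have c0 : 0 <= c by apply: le_ereal_inf_tmp => _ [B [mB _] <-].
have cfin : c \is a fin_num.
  rewrite ge0_fin_numE// (le_lt_trans (cle setT measurableT _))//.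
  by rewrite ltey_eq fin_num_measure.
have inv0 n : (0 < n.+1%:R^-1 :> R)%R by rewrite invr_gt0.
have small e : (0 < e)%R -> exists n, (n.+1%:R^-1 < e :> R)%R.
  move=> e0; have [n _ /(_ n (leqnn n)) nP] := near_infty_natSinv_lt (PosNum e0).
  by exists n.
have /choice[C CP] n : exists C : T -> set X,
    [/\ forall t, closed (C t) /\ C t `<=` V, hit_measurable C,
    [set z | C z.2 z.1] `<=` A & c - (n.+1%:R^-1)%:E <= mu (snd @` [set z | C z.2 z.1])].
  apply: suslin_inner_compact => // -[B [mB AB Bc]].
  have := le_trans (cle B mB AB) Bc.
  rewrite -(fineK cfin) -EFinB lee_fin lerDl oppr_ge0; apply/negP.
  by rewrite -ltNge.
have /choice[B BP] n : exists B, [/\ measurable B, snd @` A `<=` B &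
    mu B < c + (n.+1%:R^-1)%:E].
  have [_ [B [mB AB] <-] Bc] := lb_ereal_inf_adherent (inv0 n) cfin.
  by exists B.
have sC n : selectable [set z | C n z.2 z.1].
  have [CV hC _ _] := CP n.
  by apply: (@hit_measurable_selectable _ _ _ U V) => // t; have [] := CV t.
pose W := snd @` \bigcup_n [set z | C n z.2 z.1].
have sW := selectable_bigcup sC.
have mW : measurable W by have [f []] := sW.
have CA : \bigcup_n [set z | C n z.2 z.1] `<=` A.
  by move=> z [n _ Cz]; have [_ _ + _] := CP n; apply.
apply: (@selectable_negligible _ _ _ _ mu) sW => //.
pose B' := \bigcap_n B n.
have mB' : measurable B' by apply: bigcap_measurableType => n _; have [] := BP n.
have AB' : snd @` A `<=` B' by move=> t At n _; have [_ + _] := BP n; apply.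
have WB' : W `<=` B' by move=> t [z /CA Az <-]; apply: AB'; exists z.
have Wfin : mu W \is a fin_num by rewrite fin_num_measure.
(* Null because [mu B' <= c <= mu W], by the outer covers [B n] and the inner sets [C n]
   respectively. *)
exists (B' `\` W); split; first exact: measurableD.
  rewrite measureD//; last by rewrite ltey_eq fin_num_measure.
  rewrite setIidr//; apply/eqP; rewrite eq_le; apply/andP; split; last first.
    by rewrite sube_ge0 ?le_measure ?inE// fin_num_measure.
  rewrite sube_le0; apply: (@le_trans _ _ c).
    apply/lee_addgt0Pr => e /small[n ne]; have [mB _ Bc] := BP n.
    apply: (@le_trans _ _ (mu (B n))).
      by apply: le_measure; rewrite ?inE// => t; exact.
    by apply: (le_trans (ltW Bc)); rewrite leeD2l// lee_fin ltW.
  apply/lee_addgt0Pr => e /small[n ne]; have [_ _ _ Cc] := CP n.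
  rewrite -leeBlDr//; apply: le_trans (le_trans Cc _).
    by rewrite leeB// lee_fin ltW.
  apply: le_measure; rewrite ?inE//; first by have [f []] := sC n.
  by move=> t [z Cz <-]; exists z => //; exists n.
by move=> t [At nWt]; split => //; exact: AB'.
Qed.

Lemma suslin_selectable (A : set (X * T)) (V : nat -> set X) :
  (forall n, compact (V n)) -> (forall n, closed (V n)) ->
  \bigcup_n V n = setT -> suslin A -> selectable A.
Proof.
move=> Vco cV VT sA.
have -> : A = \bigcup_n (A `&` V n `*` setT).
  apply/seteqP; split => [z Az|z [n _ []//]].
  have : (\bigcup_n V n) z.1 by rewrite VT.
  by case=> n _ Vz; exists n.
apply: selectable_bigcup => n; apply: (@suslin_compact_selectable _ (V n)) => //.
  apply: suslinI => //; exact: suslin_rectangle.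
by move=> z [_ []].
Qed.

End general.

(** [K n] consists of the points at distance at least [1/(n+1)] from the complement of [U]. *)
Lemma open_Fsigma (V : normedModType R) (U : set V) : open U ->
  exists K : nat -> set V, (forall n, closed (K n)) /\ U = \bigcup_n K n.
Proof.
move=> oU; exists (fun n => ~` \bigcup_(y in ~` U) ball y n.+1%:R^-1); split.
  by move=> n; apply: open_closedC; apply: bigcup_open => y _; exact: ball_open.
apply/seteqP; split => [x Ux|x [n _ nx]].
  have /nbhs_ballP[e /= e0 eU] : nbhs x U by exact: open_nbhs_nbhs.
  have [n _ /(_ n (leqnn n)) /= ne] := near_infty_natSinv_lt (PosNum e0).
  exists n => // -[y nUy /ball_sym yx]; apply: nUy; apply: eU.
  exact: le_ball (ltW ne) _ yx.
apply: contrapT => nUx; apply: nx; exists x => //.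
by apply: ballxx; rewrite invr_gt0.
Qed.

Lemma separating_halfspaces (p : nat) : exists U : nat -> set 'rV[R]_p,
  (forall k, closed (U k)) /\
  forall x y, (forall k, U k x <-> U k y) -> x = y.
Proof.
pose H (iq : 'I_p * rat) := [set v : 'rV[R]_p | v ord0 iq.1 <= ratr iq.2].
(* Half-spaces with rational bounds, enumerated by their codes; an integer coding no pair gives the
   whole space. *)
exists (fun k => if unpickle k is Some iq then H iq else setT); split.
  move=> k; case: unpickle => [[i q]|]; last exact: closedT.
  have := @closed_comp _ _ (fun v : 'rV[R]_p => v ord0 i) [set x | x <= ratr q].
  by apply; [move=> v _; exact: coord_continuous|exact: closed_le].
move=> x y xy; apply/rowP => i.
have {}xy q : (x ord0 i <= ratr q) <-> (y ord0 i <= ratr q).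
  by have := xy (pickle (i, q)); rewrite pickleK.
have [xi|xi|//] := ltgtP (x ord0 i) (y ord0 i); have [q] := rat_in_itvoo xi;
  rewrite in_itv /= => /andP[q1 q2]; have [h1 h2] := xy q.
- by have := h1 (ltW q1); rewrite leNgt q2.
- by have := h2 (ltW q1); rewrite leNgt q2.
Qed.

Theorem measurable_selection (p : nat) (A : set (borel_rV R p * T)) :
  measurable A -> exists f : T -> borel_rV R p,
    [/\ measurable (snd @` A), measurable_fun (snd @` A) f &
     forall t, (snd @` A) t -> A (f t, t)].
Proof.
move=> mA; have [U [cU sepU]] := separating_halfspaces p.
have sA := measurable_suslin (@open_Fsigma 'rV[R]_p) mA.
pose V n := [set v : 'rV[R]_p | `|v| <= n%:R].
have cV n : closed (V n).
  have := @closed_comp _ _ (fun v : 'rV[R]_p => `|v|) [set x | x <= n%:R].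
  by apply; [move=> v _; exact: norm_continuous|exact: closed_le].
have Vco n : compact (V n).
  apply: bounded_closed_compact => //; exists n%:R; split; first exact: realn.
  by move=> x nx v /le_trans; apply; exact: ltW.
have VT : \bigcup_n V n = setT.
  apply/seteqP; split => // v _; exists (Num.bound `|v|) => //=.
  by apply: ltW; apply: archi_boundP.
have [f [mD fA fL]] := suslin_selectable cU sepU Vco cV VT sA.
exists f; split => //; apply: measurability; first by [].
move=> _ [B oB <-].
have := measurableD mD (fL _ (open_closedC oB)).
congr (measurable _); apply/seteqP; split => [t [Dt nt]|t [Dt Bt]].
  by split => //; apply: contrapT => nBt; apply: nt.
by split => // -[].
Qed.

End measurable_selection.

(** * Existence of zeros *)

HB.instance Definition _ (R : realType) (m n : nat) := Complete.on 'M[R]_(m, n).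

Section matrix_norms.
Context (R : realType).

Lemma mx_norm_le (m n : nat) (A : 'M[R]_(m, n)) (k : R) :
  0 <= k -> (forall i j, `|A i j| <= k) -> `|A| <= k.
Proof.
move=> k0 Ak; rewrite [leLHS]/Num.Def.normr/= mx_normrE.
by apply: bigmax_le => //= -[i j] _; exact: Ak.
Qed.

Lemma mx_norm_ge (m n : nat) (A : 'M[R]_(m, n)) i j : `|A i j| <= `|A|.
Proof.
rewrite [leRHS]/Num.Def.normr/= mx_normrE.
exact: (le_bigmax _ (fun ij : 'I_m * 'I_n => `|A ij.1 ij.2|) (i, j)).
Qed.

Lemma norm_mulmx_le (m n q : nat) (A : 'M[R]_(m, n)) (B : 'M[R]_(n, q)) :
  `|A *m B| <= n%:R * `|A| * `|B|.
Proof.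
apply: mx_norm_le => [|i j]; first by rewrite !mulr_ge0.
rewrite mxE (le_trans (ler_norm_sum _ _ _))//.
apply: (@le_trans _ _ (\sum_(k < n) `|A| * `|B|)).
  by apply: ler_sum => k _; rewrite normrM ler_pM// mx_norm_ge.
by rewrite sumr_const card_ord -mulrA mulr_natl.
Qed.

Variable p : nat.

Lemma norm_coord_le_euclid (v : 'rV[R]_p) j : `|v ord0 j| <= euclid v.
Proof.
rewrite -sqrtr_sqr ler_wsqrtr// (bigD1 j)//= lerDl.
by apply: sumr_ge0 => i _; exact: sqr_ge0.
Qed.

Lemma euclid_le_norm (v : 'rV[R]_p) : euclid v <= p%:R * `|v|.
Proof.
rewrite -[leRHS]ger0_norm ?mulr_ge0// -sqrtr_sqr ler_wsqrtr//.
apply: (@le_trans _ _ (\sum_(i < p) `|v| ^+ 2)).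
  by apply: ler_sum => i _; rewrite -real_normK ?num_real// lerXn2r ?nnegrE// mx_norm_ge.
rewrite sumr_const card_ord exprMn -[_ *+ p]mulr_natl ler_wpM2r ?sqr_ge0//.
by rewrite -natrX ler_nat; case: (p) => // k; rewrite expnS expn1 leq_pmulr.
Qed.

(** Each row of [A] is the image of a unit vector, and its entries are bounded by its Euclidean
    norm. The bound [ub] makes the supremum genuine. *)
Lemma norm_le_opnorm (A : 'M[R]_p) : `|A| <= opnorm A.
Proof.
have ub : has_ubound [set euclid (v *m A) | v in [set v : 'rV[R]_p | euclid v <= 1]].
  exists (p%:R * (p%:R * 1 * `|A|)) => _ [v /= v1 <-].
  apply: le_trans (euclid_le_norm _) _; rewrite ler_wpM2l//.
  apply: le_trans (norm_mulmx_le _ _) _; rewrite ler_wpM2r// ler_wpM2l//.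
  apply: mx_norm_le => // i j; rewrite ord1.
  exact: le_trans (norm_coord_le_euclid _ _) v1.
have e1 (i : 'I_p) : euclid (delta_mx ord0 i : 'rV[R]_p) <= 1.
  rewrite /euclid (bigD1 i)//= big1 => [|j ji]; last first.
    by rewrite mxE (negbTE ji) andbF expr0n.
  by rewrite mxE !eqxx expr1n addr0 sqrtr1.
have opnorm_ge (i : 'I_p) : euclid (delta_mx ord0 i *m A) <= opnorm A.
  by apply: ub_le_sup => //; exists (delta_mx ord0 i) => //; exact: e1.
have Aop i j : `|A i j| <= opnorm A.
  apply: le_trans (opnorm_ge i); rewrite -rowE.
  by apply: le_trans (norm_coord_le_euclid _ j); rewrite mxE.
apply: mx_norm_le => //; apply: le_trans (_ : euclid (0 *m A) <= _).
  exact: sqrtr_ge0.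
apply: ub_le_sup => //; exists 0 => //=.
by rewrite /euclid big1 ?sqrtr0// => i _; rewrite mxE expr0n.
Qed.

End matrix_norms.

Section mean_value.
Context (R : realType) (V : normedModType R) (q : nat).

(* Subtracting the affine map [t |-> t *: w] lets one compare [f] with a
   linear map without differentiating the latter. *)
Lemma norm_increment_le (f : V -> 'rV[R]_q) (y v : V) (w : 'rV[R]_q) (k : R) :
  (forall t : R, t \in `[0, 1]%R ->
    derivable f (y + t *: v) v /\ `|'D_v f (y + t *: v) - w| <= k) ->
  `|f (y + v) - f y - w| <= k.
Proof.
move=> fk; have k0 : 0 <= k.
  have [|_] := fk 0; first by rewrite in_itv /= lexx ler01.
  exact: le_trans (normr_ge0 _).
apply: mx_norm_le => // i j; rewrite ord1 {i}.
pose F (t : R) : R := f (y + t *: v) ord0 j.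
have dF (t : R) : t \in `[0, 1]%R -> is_derive t (1 : R) F ('D_v f (y + t *: v) ord0 j).
  move=> t01; have [df _] := fk t t01.
  (* The difference quotient of [F] in direction 1 is that of a coordinate of [f] in direction
     [v]. *)
  have E : (fun h => h^-1 *: ((F \o shift t) (h *: (1 : R)) - F t)) =
      (fun h => h^-1 *: (((fun x => f x ord0 j) \o shift (y + t *: v)) (h *: v)
         - f (y + t *: v) ord0 j)).
    apply/funext => h; rewrite /F /= scalerDl addrCA.
    by rewrite /GRing.scale /= mulr1.
  apply: DeriveDef.
    by rewrite /derivable E; exact: ((derivable_mxP _ _ _).1 df).
  by rewrite (derive_mx df) mxE /derive E.
pose H (t : R) : R := F t - t * w ord0 j.
pose dH (t : R) : R := 'D_v f (y + t *: v) ord0 j - w ord0 j.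
have HdH (t : R) : t \in `[0, 1]%R -> is_derive t (1 : R) H (dH t).
  move=> /dF dFt.
  have := is_deriveB dFt (is_deriveM (is_derive_id t 1) (is_derive_cst (w ord0 j) t 1)).
  by rewrite scaler0 add0r /GRing.scale/= mulr1.
have cH : {within `[0, 1], continuous H}.
  by apply: derivable_within_continuous => t /HdH[].
have oH (t : R) : t \in `]0, 1[%R -> is_derive t (1 : R) H (dH t).
  by move=> t01; apply: HdH; exact: subset_itv_oo_cc t01.
have [t t01] := MVT_segment ler01 oH cH.
rewrite /H /dH subr0 mulr1 mul1r mul0r subr0 /F scale1r scale0r addr0 => E.
rewrite !mxE (_ : _ - _ - _ = 'D_v f (y + t *: v) ord0 j - w ord0 j); last first.
  by rewrite -E; lra.
have [_ /(le_trans _)] := fk t t01; apply.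
by have := mx_norm_ge ('D_v f (y + t *: v) - w) ord0 j; rewrite !mxE.
Qed.

End mean_value.

Lemma norm_segment_le (R : realType) (V : normedModType R) (x y c : V) (r t : R) :
  t \in `[0, 1]%R -> `|x - c| <= r -> `|y - c| <= r ->
  `|y + t *: (x - y) - c| <= r.
Proof.
rewrite in_itv/= => /andP[t0 t1] xr yr.
have -> : y + t *: (x - y) - c = t *: (x - c) + (1 - t) *: (y - c).
  rewrite scalerBl scale1r addrCA -scalerBr opprB subrKA.
  by rewrite addrAC.
rewrite (le_trans (ler_normD _ _))// !normrZ !ger0_norm ?subr_ge0//.
rewrite (_ : r = t * r + (1 - t) * r); last by ring.
by apply: lerD; rewrite ler_wpM2l ?subr_ge0.
Qed.

(** * Zeros by a simplified Newton iteration *)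

Section newton.
Context (R : realType) (p : nat).
Implicit Types (f : 'rV[R]_p -> 'rV[R]_p) (c : 'rV[R]_p).

Lemma zero_in_ball f c (A : 'M[R]_p) (r eta : R) :
  A \in unitmx -> 0 < r ->
  (forall x, `|x - c| <= r -> differentiable f x /\ `|jacobian f x - A| <= eta) ->
  p%:R * (p%:R * eta) * `|invmx A| <= 2^-1 ->
  p%:R * `|f c| * `|invmx A| <= r / 2 ->
  exists x, `|x - c| <= r /\ f x = 0.
Proof.
move=> uA r0 fr small_eta small_fc.
set B := invmx A in small_eta small_fc *.
pose phi x := x - f x *m B.
pose U := [set x | `|x - c| <= r].
have Uc : U c by rewrite /U /= subrr normr0 ltW.
have lip x y : U x -> U y -> `|phi x - phi y| <= 2^-1 * `|x - y|.
  move=> Ux Uy.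
  have -> : phi x - phi y = - ((f x - f y - (x - y) *m A) *m B).
    by rewrite /phi !mulmxBl -!mulmxA mulmxV// !mulmx1 [RHS]opprB !opprD !opprK addrACA.
  rewrite normrN (le_trans (norm_mulmx_le _ _))//.
  have -> : f x - f y = f (y + (x - y)) - f y by rewrite [y + _]addrC subrK.
  have fxy : `|f (y + (x - y)) - f y - (x - y) *m A| <= p%:R * `|x - y| * eta.
    apply: norm_increment_le => t t01.
    have [df Jf] := fr _ (norm_segment_le t01 Ux Uy).
    split; first exact: diff_derivable.
    rewrite deriveEjacobian// -mulmxBr (le_trans (norm_mulmx_le _ _))//.
    by rewrite ler_wpM2l// mulr_ge0.
  apply: (@le_trans _ _ (p%:R * (p%:R * `|x - y| * eta) * `|B|)).
    by rewrite ler_wpM2r// ler_wpM2l.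
  apply: le_trans (ler_wpM2r (normr_ge0 (x - y)) small_eta).
  by rewrite le_eqVlt; apply/orP; left; apply/eqP; ring.
(* The contraction contributes at most [r / 2], the displacement of the centre the other half. *)
have phiU : {homo phi : x / U x >-> U x}.
  move=> x Ux; rewrite /U /= (splitr r).
  have -> : phi x - c = (phi x - phi c) + (phi c - c) by rewrite addrA subrK.
  apply: (le_trans (ler_normD _ _)); apply: lerD.
    apply: (le_trans (lip _ _ Ux Uc)); rewrite mulrC ler_wpM2r//.
  by rewrite /phi addrAC subrr add0r normrN (le_trans (norm_mulmx_le _ _)).
have clU : closed U.
  rewrite (_ : U = closed_ball c r); first exact: closed_ball_closed.
  by rewrite closed_ballE//; apply/seteqP; split => x; rewrite /U /closed_ball_/= distrC.
have half0 : 0 <= 2^-1 :> R by rewrite invr_ge0.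
have [||x Ux xE] := @banach_fixed_point R 'rV[R]_p U (mkfun_fun phiU) _ clU.
- exists (NngNum half0); split => /=; first by rewrite invf_lt1// ltr1n.
  by move=> [x y] /= [Ux Uy]; exact: lip.
- by exists c.
exists x; split => //.
have fB : f x *m B = 0.
  move: xE => /eqP; rewrite /= /mkfun /phi eq_sym subr_eq addrC -subr_eq subrr.
  by move=> /eqP <-.
by rewrite -(mulmx1 (f x)) -(mulVmx uA) mulmxA fB mul0mx.
Qed.

Lemma zeros_converge (M : set 'rV[R]_p) (Gn : nat -> 'rV[R]_p -> 'rV[R]_p)
    (G : 'rV[R]_p -> 'rV[R]_p) c (e : R) :
  open M -> M c -> 0 < e ->
  (fun n => Gn n c) @ \oo --> (0 : 'rV[R]_p) ->
  (forall n x, M x -> differentiable (Gn n) x) ->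
  {for c, continuous (jacobian G)} ->
  (fun n => ereal_sup [set (opnorm (jacobian (Gn n) x - jacobian G x))%:E
                      | x in M]) @ \oo --> (0 : \bar R) ->
  jacobian G c \in unitmx ->
  \forall n \near \oo, exists x, [/\ M x, `|x - c| <= e & Gn n x = 0].
Proof.
move=> oM Mc e0 Gn0 dGn cG JGn uA.
set A := jacobian G c in uA *.
(* Continuity of the limit Jacobian and uniform convergence each cost [eta]; [L * (2 * eta) = 1/2]
   is the contraction bound. The added 1 keeps [L] positive. *)
pose L := p%:R * p%:R * `|invmx A| + 1.
have L0 : 0 < L by rewrite ltr_wpDl// !mulr_ge0.
pose eta := (4 * L)^-1.
have eta0 : 0 < eta by rewrite invr_gt0 mulr_gt0.
have : \forall x \near c, M x /\ `|A - jacobian G x| < eta.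
  apply: filterI; first exact: open_nbhs_nbhs.
  by move/cvgrPdist_lt : cG => /(_ _ eta0).
move=> /nbhs_ballP[s /= s0 sM].
(* Halving [s] puts the closed ball of radius [r] inside the open ball of radius [s]. *)
pose r := Num.min e (s / 2).
have r0 : 0 < r by rewrite lt_min e0 divr_gt0.
have rM x : `|x - c| <= r -> M x /\ `|A - jacobian G x| < eta.
  move=> xr; apply: sM; rewrite -ball_normE /= distrC (le_lt_trans xr)//.
  by rewrite gt_min; apply/orP; right; rewrite ltr_pdivrMr// ltr_pMr// ltr1n.
pose D := p%:R * `|invmx A| + 1.
have D0 : 0 < D by rewrite ltr_wpDl// mulr_ge0.
have small : 0 < r / (2 * D) by rewrite divr_gt0// mulr_gt0.
have JGn_eta : \forall n \near \oo,
    (ereal_sup [set (opnorm (jacobian (Gn n) x - jacobian G x))%:E | x in M] < eta%:E)%E.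
  have := JGn [set y | (y < eta%:E)%E]; apply.
  apply: open_nbhs_nbhs; split => /=; last by rewrite lte_fin.
  exact: open_ereal_lt_ereal.
near=> n.
have [|||x [xr Gx]] := @zero_in_ball (Gn n) c A r (2 * eta) uA r0.
- move=> x /rM[Mx GA]; split; first exact: dGn.
  have Jn : `|jacobian (Gn n) x - jacobian G x| <= eta.
    apply: le_trans (norm_le_opnorm _) _; rewrite -lee_fin.
    apply: le_trans (ltW (near JGn_eta n _)) => //.
    by apply: ereal_sup_ubound; exists x.
  rewrite distrC in GA; apply: (le_trans (ler_distD (jacobian G x) _ _)).
  rewrite [leRHS]mulr_natl mulr2n.
  by apply: lerD; [exact: Jn|exact: ltW GA].
- have -> : p%:R * (p%:R * (2 * eta)) * `|invmx A| = (L - 1) * (2 * eta).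
    by rewrite /L; ring.
  rewrite (@le_trans _ _ (L * (2 * eta)))//; first by rewrite ler_wpM2r//; lra.
  rewrite /eta; rewrite le_eqVlt; apply/orP; left; apply/eqP; field.
  by rewrite gt_eqF.
- have Gc : `|Gn n c| <= r / (2 * D).
    by near: n; move/cvgr0Pnorm_le : Gn0; exact.
  have -> : p%:R * `|Gn n c| * `|invmx A| = `|Gn n c| * (D - 1) by rewrite /D; ring.
  apply: (@le_trans _ _ (`|Gn n c| * D)); first by rewrite ler_wpM2l//; lra.
  apply: (le_trans (ler_wpM2r (ltW D0) Gc)).
  rewrite le_eqVlt; apply/orP; left; apply/eqP; field.
  by rewrite gt_eqF.
exists x; split => //; first by have [] := rM x xr.
by rewrite (le_trans xr)// ge_min lexx.
Unshelve. all: by end_near. Qed.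

End newton.

(** * Estimators *)

Section estimators.
Context (R : realType) (d : measure_display) (Omega : measurableType d).
Variables (P : probability Omega R) (p : nat) (F : set (set Omega)).
Hypothesis Fcomplete : complete_subfield P F.

Let sF : sigma_algebra setT F. Proof. by have [] := Fcomplete. Qed.

Let FE : (@measurable _ (g_sigma_algebraType F)) = F.
Proof. exact: measurable_g_measurableTypeE. Qed.

(** The restriction of [P] to [F] is realised as the law of the identity map into [(Omega, F)]; it
    is complete by hypothesis. *)
Lemma subfield_selection (A : set (borel_rV R p * g_sigma_algebraType F)) :
  measurable A -> exists f : g_sigma_algebraType F -> borel_rV R p,
    [/\ measurable (snd @` A), measurable_fun (snd @` A) f &
     forall w, (snd @` A) w -> A (f w, w)].
Proof.
have [_ FsubM Fnegl] := Fcomplete.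
have mid : measurable_fun setT (idfun : Omega -> g_sigma_algebraType F).
  by move=> _ B; rewrite FE setTI; exact: FsubM.
pose X : {mfun Omega >-> g_sigma_algebraType F} := mfun_Sub (mem_set mid).
apply: (@measurable_selection _ _ _ (distribution P X)) => N [B [mB B0 NB]].
rewrite FE; apply: (Fnegl _ B) => //; first by rewrite -FE.
Qed.

Variables (Theta : set 'rV[R]_p) (G : 'rV[R]_p -> Omega -> 'rV[R]_p).
Hypotheses (mTheta : measurable (Theta : set (borel_rV R p)))
  (mG : estimating_function Theta F G).

Lemma close_estimator (c : 'rV[R]_p) (N : nat) :
  exists that, is_estimator Theta F G that /\
    forall k w, (k < N)%N ->
      (exists x, [/\ Theta x, `|x - c| <= k.+1%:R^-1 & G x w = 0]) ->
      exists x, that w = Some x /\ `|x - c| <= k.+1%:R^-1.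
Proof.
pose T := g_sigma_algebraType F.
have mclosed (B : set 'rV[R]_p) : closed B -> measurable (B : set (borel_rV R p)).
  move=> cB; rewrite -[B]setCK; apply: measurableC; apply: sub_sigma_algebra.
  exact: closed_openC.
pose Z : set (borel_rV R p * T) := [set z | Theta z.1 /\ G z.1 z.2 = 0].
have mZ : measurable Z.
  have mD : measurable ((Theta : set (borel_rV R p)) `*` [set: T]) by exact: measurableX.
  have m0 : measurable ([set (0 : 'rV[R]_p)] : set (borel_rV R p)).
    by apply: mclosed; apply: compact_closed; [exact: norm_hausdorff|exact: compact_set1].
  have := mG mD m0; congr (measurable _); apply/seteqP.
  by split => [z [[Tz _] Gz]|z [Tz Gz]].
pose B k : set (borel_rV R p) := [set x : 'rV[R]_p | `|x - c| <= k.+1%:R^-1].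
have mB k : measurable (B k).
  apply: mclosed; rewrite (_ : B k = closed_ball c k.+1%:R^-1).
    exact: closed_ball_closed.
  rewrite closed_ballE ?invr_gt0//; apply/seteqP.
  by split => x; rewrite /B /closed_ball_/= distrC.
pose D k : set T := snd @` (Z `&` B k `*` setT).
have mBT k : measurable (B k `*` [set: T]) by exact: measurableX.
have mD k : measurable (D k).
  have mZk : measurable (Z `&` B k `*` setT) by exact: measurableI.
  by have [f []] := subfield_selection mZk.
(* The bound of index [k] is imposed only on [D k], where some zero meets it. *)
pose A := Z `&` \bigcap_(k in `I_N) ((B k `*` setT) `|` (setT `*` ~` D k)).
have mA : measurable A.
  apply: measurableI => //; apply: bigcap_measurableType => k _.
  by apply: measurableU => //; apply: measurableX => //; exact: measurableC.
have AE : snd @` A = solvable_event Theta G.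
  apply/seteqP; split => [_ [[x w] [[/= Tx Gx] _] <-]|w [x0 Tx0 Gx0]]; first by exists x.
  suff [x [Zx xN]] : exists x, Z (x, w) /\ forall k, (k < N)%N ->
      ((B k `*` setT) `|` (setT `*` ~` D k)) (x, w) by exists (x, w).
  (* The bounds are jointly attainable: a zero in [B m] meets all earlier bounds, as the balls are
     nested; if there is none, the previous zero still serves. *)
  elim: {A mA}N => [|m [x [Zx xm]]].
    by exists x0; split => // k.
  have [[[y v] [/= Zy [By _]] yv]|nDm] := pselect (D m w).
    rewrite /= in yv; subst v; exists y; split => // k /= km.
    left; split => //=; apply: le_trans By _.
    by rewrite lef_pV2 ?posrE// ler_nat.
  exists x; split => // k /=; rewrite ltnS leq_eqVlt => /predU1P[->|km].
    by right.
  exact: xm.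
have [f []] := subfield_selection mA; rewrite AE => mS mf fA.
pose that w := if pselect (solvable_event Theta G w) then Some (f w) else None.
have thatS w : solvable_event Theta G w -> that w = Some (f w).
  by rewrite /that; case: pselect.
have thatN w : ~ solvable_event Theta G w -> that w = None.
  by rewrite /that; case: pselect.
exists that; split; first split.
- move=> C mC; rewrite -FE.
  have mSC := measurableC mS.
  have mfC := mf mS _ mC.
  have [CN|nCN] := pselect (C None).
    rewrite (_ : _ @^-1` _ = (solvable_event Theta G `&` f @^-1` (Some @^-1` C))
      `|` ~` solvable_event Theta G); first exact: measurableU.
    apply/seteqP; split => [w /= Cw|w /= [[Sw]|nSw]].
    + by have [Sw|nSw] := pselect (solvable_event Theta G w);
        [left; rewrite (thatS w Sw) in Cw|right].
    + by rewrite (thatS w Sw).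
    + by rewrite (thatN w nSw).
  rewrite (_ : _ @^-1` _ = solvable_event Theta G `&` f @^-1` (Some @^-1` C))//.
  apply/seteqP; split => [w /= Cw|w /= [Sw]]; last by rewrite (thatS w Sw).
  have [Sw|nSw] := pselect (solvable_event Theta G w).
    by rewrite (thatS w Sw) in Cw.
  by rewrite (thatN w nSw) in Cw.
- by move=> w Sw; exists (f w); have [[? ?] _] := fA w Sw; rewrite thatS.
- exact: thatN.
move=> k w kN [x [Tx xc Gx]].
have Sw : solvable_event Theta G w by exists x.
exists (f w); split; first exact: thatS.
have [_ /(_ k kN)[[]//|[_ /= nD]]] := fA w Sw.
by exfalso; apply: nD; exists (x, w).
Qed.

End estimators.

Unset Implicit Arguments.
Unset Strict Implicit.

Theorem theorem2p6 (R : realType) (d : measure_display)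
    (Omega : measurableType d) (P : probability Omega R)
    (Pcomplete : measure_is_complete P)
    (p : nat) (Theta : set 'rV[R]_p)
    (ThetaBorel : measurable (Theta : set (borel_rV R p)))
    (F : nat -> set (set Omega))
    (Fcomplete : forall n, complete_subfield P (F n))
    (Gn : nat -> 'rV[R]_p -> Omega -> 'rV[R]_p)
    (GnE : forall n, estimating_function Theta (F n) (Gn n))
    (thetabar : 'rV[R]_p) (thetabar_int : Theta° thetabar)
    (M : set 'rV[R]_p) (Mopen : open M) (Mthetabar : M thetabar)
    (MTheta : M `<=` Theta)
    (G : 'rV[R]_p -> Omega -> 'rV[R]_p)
    (Gn_thetabar :
      {ae P, forall w, (fun n => Gn n thetabar w) @ \oo --> (0 : 'rV[R]_p)})
    (G_thetabar : {ae P, forall w, G thetabar w = 0})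
    (GC1 : {ae P, forall w, C1_on M (G^~ w) /\
      forall n, C1_on M ((Gn n)^~ w)})
    (dGn_cvg : {ae P, forall w,
      (fun n => ereal_sup [set (opnorm (jacobian ((Gn n)^~ w) theta -
                                        jacobian (G^~ w) theta))%:E
                           | theta in M]) @ \oo --> (0 : \bar R)})
    (dG_unit : {ae P, forall w, jacobian (G^~ w) thetabar \in unitmx}) :
  exists2 that : nat -> Omega -> option 'rV[R]_p,
    forall n, is_estimator Theta (F n) (Gn n) (that n) &
    strongly_consistent P thetabar that.
Proof.
have /choice[that thatP] n :=
  close_estimator (Fcomplete n) ThetaBorel (GnE n) thetabar n.
exists that => [n|]; first by have [] := thatP n.
apply: filterS2 (filterI Gn_thetabar GC1) (filterI dGn_cvg dG_unit).
move=> w [Gn0 [GC GnC]] [JGn uG].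
apply/cvgr0Pnorm_lt => e e0.
(* The factor [p] converts the sup norm into the Euclidean one; dividing [e] by [p.+1] also covers
   [p = 0]. *)
have [k ke] : exists k : nat, p%:R * k.+1%:R^-1 < e :> R.
  have e'0 : 0 < e / p.+1%:R by rewrite divr_gt0.
  have [k _ /(_ k (leqnn k)) /= kP] := near_infty_natSinv_lt (PosNum e'0).
  exists k; move: kP; rewrite /= ltr_pdivlMr// mulrC; apply: le_lt_trans.
  by rewrite ler_wpM2r ?invr_ge0// ler_nat.
have inv0 : 0 < k.+1%:R^-1 :> R by rewrite invr_gt0.
have Hn := zeros_converge Mopen Mthetabar inv0 Gn0
  (fun n x Mx => (GnC n x Mx).1) (GC _ Mthetabar).2 JGn uG.
near=> n.
have [_ /(_ k w)[||x [-> xc]]] := thatP n.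
(* From [n = k + 1] on, the bound of index [k] is among those used by the [n]-th estimator. *)
- by near: n; exists k.+1.
- have [//|x [Mx xc Gx]] := near Hn n.
  by exists x; split => //; exact: MTheta.
rewrite /dist_delta ger0_norm ?sqrtr_ge0//.
apply: le_lt_trans (euclid_le_norm _) (le_lt_trans _ ke).
by rewrite ler_wpM2l.
Unshelve. all: by end_near. Qed.
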